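(* Suppose that $X$ and $X^*$ are uniformly convex (real) Banach spaces. Let $A_1$ and $A_2$ be maximal monotone operators from $X$ to $X^*$, with minimal-norm selections $A_1^\circ$ and $A_2^\circ$. If there exist $x_0\in D(A_1)\cap D(A_2)$ and $r>0$ such that $D(A_1)\cap B(x_0;r)=D(A_2)\cap B(x_0;r)$ and $A_1^\circ=A_2^\circ$ on $D(A_1)\cap B(x_0;r)$, then $A_1=A_2$ on $D(A_1)\cap B(x_0;r)$ (that is, $A_1x=A_2x$ for every $x$ in this set). In particular, if $D(A_1)=D(A_2)$ and $A_1^\circ=A_2^\circ$, then $A_1=A_2$.
   Context: $X^*$ is the continuous dual of the real Banach space $X$, $\langle\cdot,\cdot\rangle$ the duality pairing, and $B(x_0;r)$ the open ball in $X$ with center $x_0$ and radius $r$. For a set-valued operator $A:X\rightrightarrows X^*$, $D(A)=\{x\in X: Ax\neq\emptyset\}$. $A$ is monotone if $\langle x^*-y^*,x-y\rangle\ge 0$ whenever $x^*\in Ax$, $y^*\in Ay$, and maximal monotone if in addition its graph is not properly contained in the graph of another monotone operator. In this setting, for $x\in D(A)$ the set $Ax$ is nonempty, closed and convex, so it has a unique element of minimal norm, denoted $A^\circ x$; the map $A^\circ:D(A)\to X^*$ is the minimal-norm selection of $A$. *)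

(* Defs.v *)
From HB Require Import structures.
From mathcomp Require Import all_boot all_order all_algebra.
From mathcomp Require Import all_classical all_reals.
From mathcomp Require Import topology normedtype.

Set Implicit Arguments.
Unset Strict Implicit.
Unset Printing Implicit Defensive.

Import Order.TTheory GRing.Theory Num.Def Num.Theory.
Import numFieldTopology.Exports numFieldNormedType.Exports.

Local Open Scope classical_set_scope.
Local Open Scope ring_scope.

Section dual.
Variables (R : realType) (X : normedModType R).

Definition in_dual : {pred (X -> R^o)} :=
  fun f => `[< linear f /\ continuous f >].

(* The continuous dual X^*; the coercion to functions makes the duality
   pairing <f, x> an application, f x. *)
Record dual := Dual { dual_fun :> X -> R^o ; dual_funP : dual_fun \in in_dual }.

HB.instance Definition _ := [isSub for dual_fun].
HB.instance Definition _ := [Choice of dual by <:].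

Lemma dual_linear (f : dual) : linear f.
Proof. by have /asboolP[] := dual_funP f. Qed.

Lemma dual_continuous (f : dual) : continuous f.
Proof. by have /asboolP[] := dual_funP f. Qed.

HB.instance Definition _ (f : dual) :=
  GRing.isLinear.Build R X R^o *:%R (dual_fun f) (dual_linear f).

Lemma in_dual_submod : submod_closed in_dual.
Proof.
split=> [|a f g /asboolP[lf cf] /asboolP[lg cg]]; apply/asboolP; split.
- by move=> a x y; rewrite scaler0 addr0.
- exact: cst_continuous.
- move=> b x y; rewrite !fctE lf lg !scalerDr !scalerA (mulrC a b).
  by rewrite -!addrA; congr (_ + _); rewrite addrCA.
- move=> x; apply: (@cvgD _ _ _ (nbhs x) _ (a \*: f) g) => //; last exact: cg.
  by apply: cvgZl_tmp; exact: cf.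
Qed.

HB.instance Definition _ :=
  GRing.isSubmodClosed.Build R (X -> R^o) in_dual in_dual_submod.
HB.instance Definition _ := [SubChoice_isSubLmodule of dual by <:].

Definition dual_norm (f : dual) : R :=
  sup [set `|f x| | x in [set x : X | `|x| <= 1]].

Lemma dual_norm_has_ubound (f : dual) :
  has_ubound [set `|f x| | x in [set x : X | `|x| <= 1]].
Proof.
have /linear_bounded_continuous/bounded_funP/(_ 1)[M fM] := @dual_continuous f.
by exists M => _ [x x1 <-]; exact: fM.
Qed.

Lemma dual_norm_ub (f : dual) (x : X) : `|x| <= 1 -> `|f x| <= dual_norm f.
Proof.
by move=> x1; apply: (ub_le_sup (dual_norm_has_ubound f)); exists x.
Qed.

Lemma dual_norm_le (f : dual) (M : R) :
  (forall x : X, `|x| <= 1 -> `|f x| <= M) -> dual_norm f <= M.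
Proof.
move=> fM; apply: ge_sup; first by exists `|f 0|, 0; rewrite //= normr0.
by move=> _ [x x1 <-]; exact: fM.
Qed.

Lemma dual_norm_ge0 (f : dual) : 0 <= dual_norm f.
Proof. by apply: le_trans (@dual_norm_ub f 0 _); rewrite ?normr0. Qed.

Lemma ler_dual_normD (f g : dual) :
  dual_norm (f + g) <= dual_norm f + dual_norm g.
Proof.
apply: dual_norm_le => x x1; rewrite [X in `|X|](_ : _ = f x + g x)//.
by rewrite (le_trans (ler_normD _ _))// lerD// dual_norm_ub.
Qed.

Lemma dual_normZ_le (a : R) (f : dual) :
  dual_norm (a *: f) <= `|a| * dual_norm f.
Proof.
apply: dual_norm_le => x x1; rewrite [X in `|X|](_ : _ = a * f x)//.
by rewrite normrM ler_wpM2l// dual_norm_ub.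
Qed.

Lemma dual_normZ (a : R) (f : dual) : dual_norm (a *: f) = `|a| * dual_norm f.
Proof.
apply/eqP; rewrite eq_le dual_normZ_le/=.
have [->|a0] := eqVneq a 0; first by rewrite normr0 mul0r dual_norm_ge0.
rewrite -ler_pdivlMl ?normr_gt0// -normfV.
by apply: le_trans (dual_normZ_le _ _); rewrite scalerA mulVf// scale1r.
Qed.

Lemma dual_norm0_eq0 (f : dual) : dual_norm f = 0 -> f = 0.
Proof.
move=> f0; apply/val_inj/funext => x /=.
have [->|x0] := eqVneq x 0; first by rewrite linear0.
have : `|f (`|x|^-1 *: x)| <= 0.
  by rewrite -f0 dual_norm_ub// normrZ normfV normr_id mulVf ?normr_eq0.
rewrite normr_le0 linearZ /= scaler_eq0 invr_eq0 normr_eq0 (negbTE x0).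
by move=> /eqP.
Qed.

HB.instance Definition _ := Lmodule_isNormed.Build R dual
  ler_dual_normD dual_normZ dual_norm0_eq0.

End dual.
Arguments dual {R} X.

Definition uniformly_convex (R : realType) (X : normedModType R) : Prop :=
  forall eps : R, 0 < eps -> exists2 delta : R, 0 < delta &
    forall x y : X, `|x| = 1 -> `|y| = 1 -> eps <= `|x - y| ->
      `|2^-1 *: (x + y)| <= 1 - delta.

Section monotone_operators.
Variables (R : realType) (X : normedModType R).
Implicit Types A B : X -> set (dual X).

Definition op_domain A : set X := [set x | A x !=set0].

Definition op_graph A : set (X * dual X) := [set p | A p.1 p.2].

Definition monotone_op A : Prop :=
  forall (x y : X) (xs ys : dual X), A x xs -> A y ys -> 0 <= (xs - ys) (x - y).

Definition maximal_monotone A : Prop :=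
  monotone_op A /\ ~ exists2 B, monotone_op B & op_graph A `<` op_graph B.

Definition min_norm_elements A (x : X) : set (dual X) :=
  [set xs | A x xs /\ forall ys, A x ys -> `|xs| <= `|ys|].

(* Meaningful for x in op_domain A with A maximal monotone and dual X uniformly
   convex, where min_norm_elements A x is a singleton; the default value 0 is
   then not used on op_domain A. *)
Definition min_norm_selection A (x : X) : dual X :=
  xget 0 (min_norm_elements A x).

End monotone_operators.

(* Main.v *)
Require Import Defs.
From HB Require Import structures.
From mathcomp Require Import all_boot all_order all_algebra.
From mathcomp Require Import all_classical all_reals.
From mathcomp Require Import topology normedtype.
From mathcomp Require Import interval_inference ring lra.

Set Implicit Arguments.
Unset Strict Implicit.
Unset Printing Implicit Defensive.

Import Order.TTheory GRing.Theory Num.Def Num.Theory.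
Import numFieldTopology.Exports numFieldNormedType.Exports.

Local Open Scope classical_set_scope.
Local Open Scope ring_scope.

(** Let [z] be in [A1 x].  For [l > 0] the Minty-Browder theorem gives [w_l] and
    [g_l] in [A2 (x + l w_l)] such that [z - g_l] is in [J w_l], [J] being the
    normalized duality mapping.  Let [f_l] be the common minimal-norm element at
    [x + l w_l]: it belongs to both [A1] and [A2], and [|f_l| <= |g_l|] stays
    bounded.  Choose [u] with [|w_u|] close to [sup |w|], and [l] much smaller
    than [u].  Monotonicity of [A2] between [g_l] and [g_u] and uniform convexity
    of [X] make [w_l - w_u] small; monotonicity of [A2] between [f_l] and [g_u]
    gives [<f_l, w_u> <= <g_u, w_u> + O(l/u)], and that of [A1] gives
    [<f_l - z, w_l> >= 0].  Hence [|w_u|^2 = <z - g_u, w_u>] is small, so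
    [sup |w| = 0], and [z = g_u] is in [A2 x].  Minimizing sequences are Cauchy
    by uniform convexity, which replaces weak compactness throughout. *)

(** * Uniform convexity in terms of squared norms *)

(** If the norms of [u] and [v] differ enough, convexity of the real square gives the gap; if they
    are nearly equal, uniform convexity applies to the normalized vectors. *)
Lemma uniformly_convex_sqr (R : realType) (V : normedModType R) (M eps : R) :
  uniformly_convex V -> 0 < eps ->
  exists2 delta : R, 0 < delta & forall u v : V, `|u| <= M -> `|v| <= M ->
    (`|u| ^+ 2 + `|v| ^+ 2) / 2 - `|2^-1 *: (u + v)| ^+ 2 < delta ->
    `|u - v| < eps.
Proof.
move=> ucV e0.
have [M0|M0] := leP M 0.
  exists 1 => // u v uM vM _.
  have /eqP-> : u == 0 by rewrite -normr_le0 (le_trans uM).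
  have /eqP-> : v == 0 by rewrite -normr_le0 (le_trans vM).
  by rewrite subrr normr0.
have [d d0 ucd] := ucV (eps / (2 * M)) ltac:(by rewrite divr_gt0// mulr_gt0).
pose d1 := Num.min d 1; have d10 : 0 < d1 by rewrite lt_min d0 ltr01.
have d1d : d1 <= d by rewrite ge_min lexx.
have d11 : d1 <= 1 by rewrite ge_min lexx orbT.
(* In the case of nearly equal norms |u| >= eps/2, so 4 eta <= |u| d1: the drop of the midpoint
   dominates the error made by normalizing. *)
pose eta := eps * d1 / 8.
have eta0 : 0 < eta by rewrite divr_gt0// mulr_gt0.
exists (eta ^+ 2 / 4); first by rewrite divr_gt0// exprn_gt0.
move=> u v; wlog vu : u v / `|v| <= `|u|.
  move=> H uM vM; have [|uv] := leP `|v| `|u|; first by move=> vu; exact: H.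
  by rewrite (addrC (_ ^+ 2)) (addrC u) (distrC u); apply: H => //; exact: ltW.
move=> uM vM; apply: contraTT; rewrite -!leNgt => uve.
have mid : `|2^-1 *: (u + v)| <= (`|u| + `|v|) / 2.
  rewrite normrZ ger0_norm ?invr_ge0// mulrC ler_wpM2r ?invr_ge0//.
  exact: ler_normD.
have := normr_ge0 (2^-1 *: (u + v)); have := normr_ge0 v.
have [uveta|uveta] := leP (`|u| - `|v|) eta; last first.
  move: mid; move: (`|u|) (`|v|) (`|2^-1 *: (u + v)|) vu uveta => a b c *.
  have : c ^+ 2 <= ((a + b) / 2) ^+ 2 by rewrite ler_pXn2r ?nnegrE//; lra.
  have : eta ^+ 2 <= (a - b) ^+ 2 by rewrite ler_pXn2r ?nnegrE//; lra.
  by move=> *; rewrite -subr_ge0; nra.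
have eta8 : eta <= eps / 8 by rewrite /eta ler_pdivrMr//; nra.
have euv : eps <= `|u| + `|v| by rewrite (le_trans uve)// ler_normB.
have v0 : 0 < `|v| by lra.
have u0 : 0 < `|u| by lra.
pose a := `|u|^-1 *: u; pose b := `|v|^-1 *: v.
have a1 : `|a| = 1 by rewrite normrZ normfV normr_id mulVf// gt_eqF.
have b1 : `|b| = 1 by rewrite normrZ normfV normr_id mulVf// gt_eqF.
have ua : u = `|u| *: a by rewrite scalerA divff ?gt_eqF// scale1r.
have vb : v = `|v| *: b by rewrite scalerA divff ?gt_eqF// scale1r.
have nv' : `|(`|u| *: b) - v| = `|u| - `|v|.
  by rewrite [in X in _ - X]vb -scalerBl normrZ b1 mulr1 ger0_norm// subr_ge0.
have ab : eps / (2 * M) <= `|a - b|.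
  rewrite ler_pdivrMr ?mulr_gt0//.
  have : eps - eta <= `|u| * `|a - b|.
    rewrite -{1}(ger0_norm (normr_ge0 u)) -normrZ scalerBr -ua.
    have := ler_distD (`|u| *: b) u v; rewrite nv'; lra.
  move: (normr_ge0 (a - b)); move: `|a - b| => c; nra.
have {ucd ab} := ucd _ _ a1 b1 ab => ucab.
(* Replacing [v] by |u| b moves the midpoint by at most eta/2. *)
have : `|2^-1 *: (u + v)| <= `|u| * (1 - d1) + eta / 2.
  have -> : 2^-1 *: (u + v) =
      `|u| *: (2^-1 *: (a + b)) - 2^-1 *: (`|u| *: b - v).
    rewrite scalerA mulrC -scalerA (scalerDr `|u|) -ua -scalerBr; congr (_ *: _).
    by rewrite opprB -addrA; congr (_ + _); rewrite addrC subrK.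
  rewrite (le_trans (ler_normB _ _))// [X in X + _]normrZ normr_id.
  rewrite [X in _ + X]normrZ nv' ger0_norm ?invr_ge0//.
  by rewrite lerD// 1?ler_wpM2l//; lra.
have u2 : 4 * eta <= `|u| * d1.
  have : eps / 2 <= `|u| by lra.
  by rewrite /eta; move: `|u| => t; nra.
move: (`|u|) (`|v|) (`|2^-1 *: (u + v)|) vu uveta u2 {mid ua vb nv'} => p q c *.
by rewrite -subr_ge0; nra.
Qed.

(** * The dual space and its completeness *)

Section dual_complete.
Variables (R : realType) (X : normedModType R).
Implicit Types f g : dual X.

Lemma dualDE f g x : (f + g) x = f x + g x. Proof. by []. Qed.
Lemma dualNE f x : (- f) x = - f x. Proof. by []. Qed.
Lemma dualBE f g x : (f - g) x = f x - g x. Proof. by []. Qed.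
Lemma dualZE (a : R) f x : (a *: f) x = a * f x. Proof. by []. Qed.
Lemma dual0E (x : X) : (0 : dual X) x = 0. Proof. by []. Qed.

Lemma dual_le_norm f x : `|f x| <= `|f| * `|x|.
Proof.
have [->|x0] := eqVneq x 0; first by rewrite linear0 !normr0 mulr0.
have nx0 : 0 < `|x| by rewrite normr_gt0.
have := @dual_norm_ub _ _ f (`|x|^-1 *: x).
rewrite normrZ normfV normr_id mulVf ?normr_eq0// lexx => /(_ isT).
rewrite linearZ/= normrZ normfV normr_id mulrC.
by rewrite ler_pdivrMr.
Qed.

Lemma dual_norm_leP f (M : R) : 0 <= M ->
  (forall x, `|f x| <= M * `|x|) -> `|f| <= M.
Proof.
move=> M0 H; apply: dual_norm_le => x x1.
by rewrite (le_trans (H x))// ler_piMr.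
Qed.

Lemma bounded_linear_dual (f : X -> R) (M : R) : linear (f : X -> R^o) ->
  (forall x, `|f x| <= M * `|x|) -> exists g : dual X, forall x, g x = f x.
Proof.
move=> lf fM.
suff fd : (f : X -> R^o) \in @in_dual R X by exists (Dual fd).
apply/asboolP; split => // .
pose F := GRing.isLinear.Build R X R^o *:%R (f : X -> R^o) lf.
pose f' : {linear X -> R^o} := HB.pack (f : X -> R^o) F.
apply: (@bounded_linear_continuous R X R^o f').
apply/linear_boundedP; exists M; split; first exact: num_real.
move=> r Mr x; apply: le_trans (fM x) _; apply: ler_wpM2r => //; exact: ltW.
Qed.

(** The limit is taken pointwise. A ball belonging to the filter passes to the limit functional
    ([key]), which gives both its boundedness and the convergence in norm. *)
Lemma dual_complete (F : set_system (dual X)) :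
  ProperFilter F -> cauchy F -> cvg F.
Proof.
move=> FF /cauchyP Fc.
have Fx (x : X) : cvg ((fun f : dual X => f x : R) @ F).
  apply/cauchy_cvgP/cauchy_exP => e e0.
  have e1 : 0 < e / (`|x| + 1) by rewrite divr_gt0// ltr_wpDl.
  have [h Fh] := Fc _ e1; exists (h x).
  rewrite nbhs_simpl /=; apply: filterS Fh => f /=.
  rewrite -!ball_normE /= => hf; rewrite -dualBE.
  apply: le_lt_trans (dual_le_norm _ _) _.
  have : `|h - f| * (`|x| + 1) < e by rewrite -ltr_pdivlMr// ltr_wpDl.
  by apply: le_lt_trans; rewrite ler_wpM2l// lerDl.
pose l x : R := lim ((fun f : dual X => f x : R) @ F).
have lx x : (fun f : dual X => f x : R) @ F --> l x by exact: Fx.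
have lin : linear (l : X -> R^o).
  move=> a x y; apply: (@cvg_unique _ _ _ _ _ _ (lx (a *: x + y))) => //.
  have -> : (fun f : dual X => f (a *: x + y) : R) =
      (fun f => a * f x + f y) by apply/funext => f; rewrite linearP.
  by apply: cvgD; [apply: cvgMr; exact: lx|exact: lx].
have key e h : F (ball h e) -> forall x, `|h x - l x| <= e * `|x|.
  move=> Fh x; apply/ler_addgt0Pr => d d0.
  have /cvgrPdist_le/(_ d d0) H := lx x.
  have [f [hf fl]] := filter_ex (filterI Fh H).
  have := ler_distD (f x) (h x) (l x).
  move: hf fl; rewrite -ball_normE /= => hf fl.
  have : `|h x - f x| <= e * `|x|.
    rewrite -dualBE; apply: le_trans (dual_le_norm _ _) _.
    by rewrite ler_wpM2r// ltW.
  rewrite (distrC (f x)); lra.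
have [h1 Fh1] := Fc 1 ltr01.
have [g gl] : exists g : dual X, forall x, g x = l x.
  apply: (@bounded_linear_dual _ (`|h1| + 1)) => // x.
  rewrite mulrDl; have := key _ _ Fh1 x; have := dual_le_norm h1 x.
  have := ler_normB (h1 x) (h1 x - l x); rewrite subKr; lra.
apply/cvg_ex; exists g; apply/cvgrPdist_le => /= e e0.
have e2 : 0 < e / 2 by rewrite divr_gt0.
have [h Fh] := Fc _ e2; apply: filterS (Fh) => f.
rewrite -ball_normE /= => hf.
have : `|h - g| <= e / 2.
  by apply: dual_norm_leP; [exact: ltW|move=> x; rewrite dualBE gl; exact: key].
have := ler_distD h g f; rewrite (distrC g h); lra.
Qed.

Lemma linearZ_dual f (a : R) x : f (a *: x) = a * f x.
Proof. exact: linearZ. Qed.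

Lemma linearB_dual f x y : f (x - y) = f x - f y.
Proof. exact: linearB. Qed.

End dual_complete.

HB.instance Definition _ (R : realType) (X : normedModType R) :=
  Uniform_isComplete.Build (dual X) (@dual_complete R X).

(** * Minimization in uniformly convex spaces *)

Section minimization.
Variables (R : realType) (V W : completeNormedModType R).

Lemma midpoint_sqr_le (U : normedModType R) (u v : U) :
  `|2^-1 *: (u + v)| ^+ 2 <= (`|u| ^+ 2 + `|v| ^+ 2) / 2.
Proof.
have := ler_normD u v; rewrite normrZ ger0_norm ?invr_ge0//.
move: (normr_ge0 (u + v)) (normr_ge0 u) (normr_ge0 v).
move: (`|u + v|) (`|u|) (`|v|) => a b c *.
have : a ^+ 2 <= (b + c) ^+ 2 by rewrite ler_pXn2r ?nnegrE//; lra.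
by have := sqr_ge0 (b - c); nra.
Qed.

Lemma uniformly_convex_cauchy (U : completeNormedModType R) (u : nat -> U)
    (M : R) : uniformly_convex U -> (forall n, `|u n| <= M) ->
  (forall n k, (n <= k)%N ->
    (`|u n| ^+ 2 + `|u k| ^+ 2) / 2 - `|2^-1 *: (u n + u k)| ^+ 2
      <= 2 * n.+1%:R^-1) ->
  cvgn u.
Proof.
move=> ucU uM H; apply/cauchy_cvgP/cauchy_exP => e e0.
have [d d0 ucd] := uniformly_convex_sqr M ucU e0.
have [N Nd] : exists N : nat, 2 * N.+1%:R^-1 < d.
  have d2 : 0 < d / 2 by rewrite divr_gt0.
  have [N _ /(_ N (leqnn N)) HN] := near_infty_natSinv_lt (PosNum d2).
  have {}HN : N.+1%:R^-1 < d / 2 := HN.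
  by exists N; rewrite mulrC -ltr_pdivlMr.
exists (u N); rewrite nbhs_simpl /=; exists N => // k /= Nk.
rewrite -ball_normE /=; apply: ucd => //.
exact: le_lt_trans (H _ _ Nk) Nd.
Qed.

(** The third coordinate is the height in an epigraph: minimizing over the epigraph of a convex
    function minimizes that function plus the half squared norms, without extended real values. *)
Definition quad_obj (p : V * W * R) : R :=
  `|p.1.1| ^+ 2 / 2 + `|p.1.2| ^+ 2 / 2 + p.2.

(** Midpoints of a minimizing sequence stay in [C], so their objective is at least the infimum; by
    uniform convexity the first two coordinates converge, and the third follows by difference. *)
Lemma quad_obj_min (C : set (V * W * R)) (K : R) :
  uniformly_convex V -> uniformly_convex W -> C !=set0 -> 0 <= K ->
  (forall p q, C p -> C q -> C (2^-1 *: (p.1.1 + q.1.1),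
     2^-1 *: (p.1.2 + q.1.2), 2^-1 * (p.2 + q.2))) ->
  (forall (x : nat -> V) (y : nat -> W) (s : nat -> R) a b c,
     (forall n, C (x n, y n, s n)) -> x @ \oo --> a -> y @ \oo --> b ->
     s @ \oo --> c -> C (a, b, c)) ->
  (forall p, C p -> - K * (1 + `|p.1.1| + `|p.1.2|) <= p.2) ->
  exists2 p, C p & forall q, C q -> quad_obj p <= quad_obj q.
Proof.
move=> ucV ucW C0 K0 Cmid Ccl CK.
pose S := [set quad_obj p | p in C].
(* The linear lower bound on the height, after completing the squares. *)
have objge p : C p ->
    (`|p.1.1| - K) ^+ 2 + (`|p.1.2| - K) ^+ 2 <= 2 * (quad_obj p + K + K ^+ 2).
  by move=> /CK; rewrite /quad_obj; nra.
have infS : has_inf S.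
  split; first by case: C0 => p Cp; exists (quad_obj p), p.
  exists (- K - K ^+ 2) => _ [p Cp <-].
  have := objge _ Cp; have := sqr_ge0 (`|p.1.1| - K).
  by have := sqr_ge0 (`|p.1.2| - K); lra.
set m := inf S.
have mle p : C p -> m <= quad_obj p.
  by move=> Cp; apply: ge_inf; [exact: infS.2|exists p].
have /choice[p Hp] (n : nat) :
    exists p, C p /\ quad_obj p < m + n.+1%:R^-1.
  have n0 : 0 < n.+1%:R^-1 :> R by rewrite invr_gt0.
  by have [_ [q Cq <-] qm] := inf_adherent n0 infS; exists q.
have Cp n := (Hp n).1; have pm n := (Hp n).2.
have inv1 n : n.+1%:R^-1 <= 1 :> R by rewrite invf_le1 ?ler1n.
pose M := K + 1 + 2 * (m + 1 + K + K ^+ 2).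
have bnd n : `|(p n).1.1| <= M /\ `|(p n).1.2| <= M.
  have := objge _ (Cp n); have := pm n; have := inv1 n; rewrite /M.
  move: `|(p n).1.1| `|(p n).1.2| (quad_obj _) (n.+1%:R^-1) => a b o i *.
  have := sqr_ge0 (a - K - 2^-1); have := sqr_ge0 (b - K - 2^-1).
  by have := sqr_ge0 (a - K); have := sqr_ge0 (b - K); split; nra.
(* The heights cancel. Both gaps are nonnegative and half their sum is at most 1/(n+1), whence the
   factor 2 for each. *)
have mid n k : (n <= k)%N ->
    (`|(p n).1.1| ^+ 2 + `|(p k).1.1| ^+ 2) / 2 -
      `|2^-1 *: ((p n).1.1 + (p k).1.1)| ^+ 2 <= 2 * n.+1%:R^-1 /\
    (`|(p n).1.2| ^+ 2 + `|(p k).1.2| ^+ 2) / 2 -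
      `|2^-1 *: ((p n).1.2 + (p k).1.2)| ^+ 2 <= 2 * n.+1%:R^-1.
  move=> nk; have := mle _ (Cmid _ _ (Cp n) (Cp k)).
  have : k.+1%:R^-1 <= n.+1%:R^-1 :> R by rewrite lef_pV2 ?posrE// ler_nat.
  move: (n.+1%:R^-1) (k.+1%:R^-1) (pm n) (pm k) => i j.
  rewrite /quad_obj /=.
  have := midpoint_sqr_le (p n).1.1 (p k).1.1.
  have := midpoint_sqr_le (p n).1.2 (p k).1.2.
  by split; lra.
have cx : cvgn (fun n => (p n).1.1).
  apply: (@uniformly_convex_cauchy V _ M) => // [n|n k /mid[]//].
  by have [] := bnd n.
have cy : cvgn (fun n => (p n).1.2).
  apply: (@uniformly_convex_cauchy W _ M) => // [n|n k /mid[]//].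
  by have [] := bnd n.
have /cvg_ex[x lx] := cx; have /cvg_ex[y ly] := cy.
have lo : quad_obj (p n) @[n --> \oo] --> m.
  apply/cvgrPdist_le => e e0.
  have [N _ HN] := near_infty_natSinv_lt (PosNum e0).
  exists N => // n /= Nn; have := pm n; have := mle _ (Cp n).
  have : n.+1%:R^-1 < e := HN n Nn.
  move: (n.+1%:R^-1) => i *; rewrite ler_norml; apply/andP; split; lra.
have ls : (p n).2 @[n --> \oo] --> m - `|x| ^+ 2 / 2 - `|y| ^+ 2 / 2.
  have -> : (fun n => (p n).2) =
     (fun n => quad_obj (p n) - `|(p n).1.1| ^+ 2 / 2 - `|(p n).1.2| ^+ 2 / 2).
    by apply/funext => n; rewrite /quad_obj; lra.
  have sqr_cvg (U : normedModType R) (u : nat -> U) (l : U) :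
      u @ \oo --> l -> `|u n| ^+ 2 / 2 @[n --> \oo] --> `|l| ^+ 2 / 2.
    by move=> ul; apply: cvgMl; apply: cvgM; apply: cvg_norm.
  by apply: cvgB; [apply: cvgB => //|]; exact: sqr_cvg.
exists (x, y, m - `|x| ^+ 2 / 2 - `|y| ^+ 2 / 2).
  apply: (Ccl _ _ _ _ _ _ _ lx ly ls) => n /=.
  by have := Cp n; case: (p n) => -[].
by move=> q /mle; apply: le_trans; rewrite /quad_obj /=; lra.
Qed.

End minimization.

(** * The Hahn-Banach theorem *)

Section hahn_banach.
Variables (R : realType) (X : lmodType R).
Implicit Types p q : X -> R.

Definition sublinear p : Prop :=
  (forall x y, p (x + y) <= p x + p y) /\
  (forall s x, 0 < s -> p (s *: x) <= s * p x).

Lemma sublinear0 p : sublinear p -> p 0 = 0.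
Proof.
move=> [_ pZ]; have := pZ 2 0 ltac:(lra); have := pZ 2^-1 0 ltac:(lra).
by rewrite !scaler0; lra.
Qed.

Lemma sublinearZ p s x : sublinear p -> 0 <= s -> p (s *: x) = s * p x.
Proof.
move=> sp; rewrite le_eqVlt => /predU1P[<-|s0].
  by rewrite scale0r mul0r sublinear0.
apply/eqP; rewrite eq_le sp.2//= -ler_pdivlMl//.
have := sp.2 s^-1 (s *: x); rewrite invr_gt0 => /(_ s0).
by rewrite scalerA mulVf ?gt_eqF// scale1r.
Qed.

Lemma sublinearN p x : sublinear p -> - p (- x) <= p x.
Proof.
by move=> sp; have := sp.1 x (- x); rewrite subrr sublinear0//; lra.
Qed.

(** For sublinear [p], this is the largest sublinear minorant of [p] with value at most [- p y] at
    [- y]. *)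
Definition ray_inf p (y x : X) : R :=
  inf [set p (x + t *: y) - t * p y | t in [set t | 0 <= t]].

Section ray_inf.
Variables (p : X -> R) (y : X).
Hypothesis sp : sublinear p.

Let has_lb x :
  has_lbound [set p (x + t *: y) - t * p y | t in [set t | 0 <= t]].
Proof.
exists (- p (- x)) => _ [t /= t0 <-]; rewrite -sublinearZ//.
by have := sp.1 (x + t *: y) (- x); rewrite addrC addKr; lra.
Qed.

Lemma ray_inf_le x t : 0 <= t -> ray_inf p y x <= p (x + t *: y) - t * p y.
Proof. by move=> t0; apply: ge_inf => //; exists t. Qed.

Lemma le_ray_inf x z :
  (forall t, 0 <= t -> z <= p (x + t *: y) - t * p y) -> z <= ray_inf p y x.
Proof.
move=> H; apply: lb_le_inf; first by exists (p (x + 0 *: y) - 0 * p y), 0 => /=.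
by move=> _ [t t0 <-]; exact: H.
Qed.

Lemma ray_inf_le_id x : ray_inf p y x <= p x.
Proof.
by apply: le_trans (ray_inf_le x (lexx 0)) _; rewrite scale0r addr0; lra.
Qed.

Lemma ray_infN : ray_inf p y (- y) <= - p y.
Proof.
apply: le_trans (ray_inf_le (- y) ler01) _.
by rewrite scale1r addNr sublinear0//; lra.
Qed.

Lemma sublinear_ray_inf : sublinear (ray_inf p y).
Proof.
split=> [x x'|s x s0].
  rewrite -lerBlDr; apply: le_ray_inf => t t0.
  rewrite lerBlDr -lerBlDl; apply: le_ray_inf => t' t'0.
  rewrite lerBlDl; apply: le_trans (ray_inf_le _ (addr_ge0 t0 t'0)) _.
  have := sp.1 (x + t *: y) (x' + t' *: y).
  by rewrite scalerDl addrACA; lra.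
rewrite mulrC -ler_pdivrMr//; apply: le_ray_inf => t t0.
rewrite ler_pdivrMr//; apply: le_trans (ray_inf_le _ (mulr_ge0 (ltW s0) t0)) _.
by rewrite -scalerA -scalerDr sublinearZ ?(ltW s0)//; lra.
Qed.

End ray_inf.

(* A pointwise minimal sublinear functional equals each of its [ray_inf]
   minorants, hence is odd, hence linear. *)
Theorem hahn_banach_minorant p0 : sublinear p0 ->
  exists l : X -> R, linear (l : X -> R^o) /\ forall x, l x <= p0 x.
Proof.
move=> sp0.
pose T := {p : X -> R | sublinear p /\ forall x, p x <= p0 x}.
(* The order is reversed, so that a maximal element is pointwise minimal. *)
pose leT (p q : T) := `[< forall x, sval q x <= sval p x >].
have [||||[p [sp pp0]] pmin] := @Zorn T leT.
- by move=> p; apply/asboolP.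
- move=> p q r /asboolP pq /asboolP qr; apply/asboolP => x.
  exact: le_trans (qr x) (pq x).
- move=> [p Hp] [q Hq] /asboolP/= pq /asboolP/= qp; apply: eq_exist => /=.
  by apply/funext => x; apply/eqP; rewrite eq_le pq qp.
- move=> A totA; have [[a Aa]|A0] := pselect (A !=set0); last first.
    exists (exist _ p0 (conj sp0 (fun x => lexx _))) => s As.
    by case: A0; exists s.
  (* A nonempty chain is bounded by its pointwise infimum, finite since every member is at least
     [- p0 (- x)] at [x]. *)
  pose q x := inf [set sval p x | p in A].
  have qle (p : T) x : A p -> q x <= sval p x.
    move=> Ap; apply: ge_inf; last by exists p.
    exists (- p0 (- x)) => _ [[r [sr rp0]] Ar <-] /=.
    by have := sublinearN x sr; have := rp0 (- x); lra.
  have le_q x z : (forall p : T, A p -> z <= sval p x) -> z <= q x.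
    move=> H; apply: lb_le_inf; first by exists (sval a x), a.
    by move=> _ [p Ap <-]; exact: H.
  have Hq : sublinear q /\ forall x, q x <= p0 x.
    split; last by move=> x; apply: le_trans (qle a x Aa) ((svalP a).2 x).
    split=> [x y|s x s0].
      rewrite -lerBlDr; apply: (le_q) => p Ap.
      rewrite lerBlDr -lerBlDl; apply: (le_q) => r Ar; rewrite lerBlDl.
      have [] := totA _ _ Ap Ar => /asboolP H.
        apply: le_trans (qle r _ Ar) _.
        by have := (svalP r).1.1 x y; have := H x; lra.
      apply: le_trans (qle p _ Ap) _.
      by have := (svalP p).1.1 x y; have := H y; lra.
    rewrite mulrC -ler_pdivrMr//; apply: (le_q) => p Ap.
    rewrite ler_pdivrMr// mulrC; apply: le_trans (qle p _ Ap) _.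
    exact: (svalP p).1.2.
  by exists (exist _ q Hq) => s As; apply/asboolP => x /=; exact: qle.
have oddp y : p (- y) = - p y.
  have Hr : sublinear (ray_inf p y) /\ forall x, ray_inf p y x <= p0 x.
    split=> [|x]; first exact: sublinear_ray_inf.
    exact: le_trans (ray_inf_le_id y sp x) (pp0 x).
  have leR : leT (exist _ p (conj sp pp0)) (exist _ (ray_inf p y) Hr).
    by apply/asboolP => x /=; exact: ray_inf_le_id.
  have rp : ray_inf p y = p := congr1 sval (pmin _ leR).
  have := ray_infN y sp; rewrite rp => le1.
  by apply/eqP; rewrite eq_le le1 /=; have := sublinearN y sp; lra.
exists p; split => // a x y.
have pD u v : p (u + v) = p u + p v.
  apply/eqP; rewrite eq_le sp.1 /=.
  by have := sp.1 (- u) (- v); rewrite -opprD !oddp; lra.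
rewrite pD; congr (_ + _); rewrite /GRing.scale /=.
have [a0|a0] := leP 0 a; first exact: sublinearZ.
have := @sublinearZ p (- a) x sp; rewrite scaleNr oddp => /(_ ltac:(lra)).
lra.
Qed.

End hahn_banach.

(** * The normalized duality mapping *)

Section duality_pair.
Variables (R : realType) (X : normedModType R).
Implicit Types (f g : dual X) (x y : X).

(* [f] belongs to the normalized duality mapping at [x]. *)
Definition duality_pair f x : Prop := f x = `|f| ^+ 2 /\ `|f| = `|x|.

Lemma dual_young f x : f x <= `|f| ^+ 2 / 2 + `|x| ^+ 2 / 2.
Proof.
apply: le_trans (ler_norm _) _; apply: le_trans (dual_le_norm _ _) _.
by move: `|f| `|x| => a b; have := sqr_ge0 (a - b); lra.
Qed.

Lemma dual_youngN f x : - (`|f| ^+ 2 / 2 + `|x| ^+ 2 / 2) <= f x.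
Proof. by have := dual_young f (- x); rewrite linearN /= normrN; lra. Qed.

Lemma duality_pair_intro f x :
  f x = `|x| ^+ 2 -> `|f| <= `|x| -> duality_pair f x.
Proof.
move=> fx fle.
suff fxn : `|f| = `|x| by split => //; rewrite fxn.
apply/eqP; rewrite eq_le fle /=.
have := le_trans (ler_norm _) (dual_le_norm f x); rewrite fx.
have [->|x0] := eqVneq x 0; first by rewrite normr0.
by rewrite expr2 ler_pM2r// normr_gt0.
Qed.

(** A linear minorant of [ray_inf] of the norm at [x] is dominated by the norm and is at most -|x|
    at [- x], so it attains |x| at [x]; it remains to rescale by |x|. *)
Lemma duality_map_exists x : exists f, duality_pair f x.
Proof.
have sn : sublinear (fun x : X => `|x|).
  by split=> [? ?|s y s0]; [exact: ler_normD|rewrite normrZ gtr0_norm].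
have [l [ll lle]] := hahn_banach_minorant (sublinear_ray_inf x sn).
have ln y : l y <= `|y| by apply: le_trans (lle y) (ray_inf_le_id x sn y).
have lN y : l (- y) = - l y.
  have := ll (-1) y 0; rewrite addr0 scaleN1r => ->.
  have := ll 1 0 0; rewrite !scale1r addr0 /GRing.scale /=; lra.
have [g gl] : exists g : dual X, forall y, g y = l y.
  apply: (@bounded_linear_dual _ _ _ 1) => // y; rewrite mul1r ler_norml.
  by have := ln y; have := ln (- y); rewrite lN normrN => *; apply/andP; split; lra.
have g1 : `|g| <= 1.
  apply: dual_norm_leP => // y; rewrite mul1r ler_norml gl.
  by have := ln y; have := ln (- y); rewrite lN normrN => *; apply/andP; split; lra.
have gx : g x = `|x|.
  apply/eqP; rewrite gl eq_le ln /=.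
  by have := ray_infN x sn; have := lle (- x); rewrite lN; lra.
exists (`|x| *: g); apply: duality_pair_intro; first by rewrite dualZE gx.
by rewrite normrZ normr_id ler_piMr.
Qed.

End duality_pair.

(** Surjectivity of the duality mapping: the solution minimizes |x|^2/2 - f x. The second coordinate
    of [C] is frozen at 0 to fit [quad_obj_min]. *)
Lemma norm_attained (R : realType) (X : completeNormedModType R) (f : dual X) :
  uniformly_convex X -> exists x, duality_pair f x.
Proof.
move=> ucX.
pose C := [set p : X * X * R | p.1.2 = 0 /\ p.2 = - f p.1.1].
have [|||||[[q y] s] /= [/= y0 sE] qmin] := @quad_obj_min R X X C `|f| ucX ucX.
- by exists (0, 0, 0); split => //=; rewrite linear0 oppr0.
- exact: normr_ge0.
- move=> p p' [/= p0 ps] [/= p'0 p's]; split => /=.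
    by rewrite p0 p'0 addr0 scaler0.
  by rewrite linearZ /= linearD /= ps p's /GRing.scale /=; lra.
- move=> x y s a b c Cn xa yb sc; split => /=.
    apply: (cvg_unique _ yb) => //.
    have -> : y = (fun=> 0) by apply/funext => n; have [] := Cn n.
    exact: cvg_cst.
  apply: (cvg_unique _ sc) => //.
  have -> : s = (fun n => - f (x n)) by apply/funext => n; have [] := Cn n.
  by apply: cvgN; apply: continuous_cvg => //; exact: dual_continuous.
- move=> [[x y] s] [/= -> ->]; rewrite normr0 addr0.
  have := dual_le_norm f x; have := ler_norm (f x); have := normr_ge0 f; nra.
subst y s.
(* Comparison with all multiples of [x], later used at the optimal t = f x / |x|^2: for x = q it
   gives (|q|^2 - f q)^2 <= 0, and in general (f x)^2 <= |q|^2 |x|^2. *)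
have qm (x : X) (t : R) :
    `|q| ^+ 2 / 2 - f q <= t ^+ 2 * `|x| ^+ 2 / 2 - t * f x.
  have Cx : C (t *: x, 0, - f (t *: x)) by [].
  have := qmin _ Cx; rewrite /quad_obj /= normr0 normrZ exprMn.
  rewrite real_normK ?num_real// linearZ /= /GRing.scale /=; lra.
have fq : f q = `|q| ^+ 2.
  have [q0|q0] := eqVneq q 0; first by rewrite q0 linear0 normr0 expr0n.
  have a0 : 0 < `|q| ^+ 2 by rewrite exprn_gt0// normr_gt0.
  have := qm q (f q / `|q| ^+ 2).
  move: (`|q| ^+ 2) (f q) a0 => a b a0.
  have -> : (b / a) ^+ 2 * a / 2 - b / a * b = - (b ^+ 2 / a) / 2.
    by field; rewrite gt_eqF.
  move=> H; have : (a - b) ^+ 2 <= 0.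
    have : a / 2 - b + b ^+ 2 / a / 2 <= 0 by lra.
    have -> : a / 2 - b + b ^+ 2 / a / 2 = (a - b) ^+ 2 / (2 * a).
      by field; rewrite gt_eqF.
    by rewrite ler_pdivrMr ?mul0r// mulr_gt0.
  move=> sqr_le0; apply/eqP; rewrite eq_sym -subr_eq0.
  by rewrite -sqrf_eq0 eq_le sqr_le0 sqr_ge0.
exists q; apply: duality_pair_intro => //.
apply: dual_norm_leP => // x.
have [->|x0] := eqVneq x 0; first by rewrite linear0 !normr0 mulr0.
have nx0 : 0 < `|x| ^+ 2 by rewrite exprn_gt0// normr_gt0.
rewrite -(@ler_pXn2r _ 2) ?nnegrE ?mulr_ge0// exprMn real_normK ?num_real//.
rewrite -ler_pdivrMr//; have := qm x (f x / `|x| ^+ 2); rewrite fq.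
move: (`|x| ^+ 2) nx0 (f x) => a a0 b.
have -> : (b / a) ^+ 2 * a / 2 - b / a * b = - (b ^+ 2 / a) / 2.
  by field; rewrite gt_eqF.
lra.
Qed.

Section duality_continuity.
Variables (R : realType) (X : normedModType R).
Implicit Types (f g : dual X) (x y h : X).

Lemma dual_eval_cvg (u : nat -> dual X) f x :
  u @ \oo --> f -> (u n x : R) @[n --> \oo] --> f x.
Proof.
move=> uf; apply/cvgrPdist_le => e e0.
have e1 : 0 < e / (`|x| + 1) by rewrite divr_gt0// ltr_wpDl.
have /cvgrPdist_le/(_ _ e1) := uf; apply: filterS => n.
rewrite ler_pdivlMr ?ltr_wpDl// => H; rewrite -dualBE.
apply: le_trans (dual_le_norm _ _) _; apply: le_trans H.
by rewrite ler_wpM2l// lerDl.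
Qed.

(** Young's inequality at the midpoint, where f x / 2 cancels |f|^2/2. *)
Lemma duality_pair_midpoint_ge f x y :
  duality_pair f x -> f y <= `|2^-1 *: (x + y)| ^+ 2.
Proof.
move=> [fx _]; have := dual_young f (2^-1 *: (x + y)).
by rewrite linearZ /= linearD /= /GRing.scale /= fx; lra.
Qed.

(** Bounds the gap of [uniformly_convex_sqr] by the pairing, so that a small pairing forces [x] and
    [y] to be close; the next lemma does the same for [f] and [g]. *)
Lemma duality_pair_midpoint f g x y : duality_pair f x -> duality_pair g y ->
  (`|x| ^+ 2 + `|y| ^+ 2) / 2 - `|2^-1 *: (x + y)| ^+ 2 <= (f - g) (x - y) / 2.
Proof.
move=> fx gy; have := duality_pair_midpoint_ge y fx.
have := duality_pair_midpoint_ge x gy; rewrite (addrC y).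
move: fx gy => [fx <-] [gy <-].
by rewrite dualBE !linearB /= fx gy; lra.
Qed.

Lemma duality_pair_dual_midpoint f g x y :
  duality_pair f x -> duality_pair g y ->
  (`|f| ^+ 2 + `|g| ^+ 2) / 2 - `|2^-1 *: (f + g)| ^+ 2 <= (f - g) (x - y) / 2.
Proof.
move=> [fx fxn] [gy gyn].
have := dual_young (2^-1 *: (f + g)) x; have := dual_young (2^-1 *: (f + g)) y.
rewrite dualBE !dualZE !dualDE !linearB /= fx gy -fxn -gyn.
by move: (`|2^-1 *: (f + g)|) => c; lra.
Qed.

(** Along the ray the pairing that bounds the gap is O(t), because |f| and |g| stay below |x| +
    |h|. *)
Lemma duality_map_ray x h f eps :
  uniformly_convex (dual X) -> 0 < eps -> duality_pair f x ->
  exists2 d, 0 < d & forall t g, 0 < t <= 1 -> t <= d ->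
    duality_pair g (x + t *: h) -> `|g - f| < eps.
Proof.
move=> uc e0 fx; pose M := `|x| + `|h|.
have M0 : 0 <= M by rewrite addr_ge0.
have [d d0 ucd] := uniformly_convex_sqr M uc e0.
have Mh0 : 0 < M * `|h| + 1 by rewrite ltr_wpDl// mulr_ge0.
exists (d / (M * `|h| + 1)); first by rewrite divr_gt0.
move=> t g /andP[t0 t1]; rewrite ler_pdivlMr// => td gx.
have fM : `|f| <= M by rewrite fx.2 lerDl.
have gM : `|g| <= M.
  rewrite gx.2; apply: le_trans (ler_normD _ _) _; rewrite lerD2l normrZ.
  by rewrite gtr0_norm// ler_piMl.
apply: ucd => //; apply: le_lt_trans (duality_pair_dual_midpoint gx fx) _.
rewrite (addrC x) addrK linearZ /= /GRing.scale /=.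
have : (g - f) h <= 2 * (M * `|h|).
  apply: le_trans (ler_norm _) _; apply: le_trans (dual_le_norm _ _) _.
  by rewrite mulrA ler_wpM2r//; apply: le_trans (ler_normB _ _) _; lra.
move=> /(ler_wpM2l (ltW t0)); lra.
Qed.

Lemma duality_inverse_ray x f g eps :
  uniformly_convex X -> 0 < eps -> duality_pair f x ->
  exists2 d, 0 < d & forall t y, 0 < t <= 1 -> t <= d ->
    duality_pair (f + t *: g) y -> `|y - x| < eps.
Proof.
move=> uc e0 fx; pose M := `|f| + `|g|.
have M0 : 0 <= M by rewrite addr_ge0.
have [d d0 ucd] := uniformly_convex_sqr M uc e0.
have Mh0 : 0 < `|g| * M + 1 by rewrite ltr_wpDl// mulr_ge0.
exists (d / (`|g| * M + 1)); first by rewrite divr_gt0.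
move=> t y /andP[t0 t1]; rewrite ler_pdivlMr// => td gy.
have xM : `|x| <= M by rewrite -fx.2 lerDl.
have yM : `|y| <= M.
  rewrite -gy.2; apply: le_trans (ler_normD _ _) _; rewrite lerD2l normrZ.
  by rewrite gtr0_norm// ler_piMl.
apply: ucd => //; apply: le_lt_trans (duality_pair_midpoint gy fx) _.
rewrite dualBE dualDE dualZE (addrC (f _)) addrK.
have : g (y - x) <= 2 * (`|g| * M).
  apply: le_trans (ler_norm _) _; apply: le_trans (dual_le_norm _ _) _.
  rewrite mulrCA ler_wpM2l//; apply: le_trans (ler_normB _ _) _; lra.
move=> /(ler_wpM2l (ltW t0)); lra.
Qed.

End duality_continuity.

(** * First-order optimality *)

Section optimality.
Variables (R : realType) (X : completeNormedModType R).
Hypotheses (ucX : uniformly_convex X) (ucX' : uniformly_convex (dual X)).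

(* First-order optimality; the derivative of the squared norms is read off
   Young's inequality at the displaced point, so that only the continuity of the
   duality mappings along rays is needed. *)
Lemma quad_obj_min_variational (C : set (X * dual X * R)) x f s y g r j q :
  (forall p, C p -> quad_obj (x, f, s) <= quad_obj p) ->
  (forall t : R, 0 < t <= 1 ->
     C (x + t *: (y - x), f + t *: (g - f), s + t * (r - s))) ->
  duality_pair j x -> duality_pair f q ->
  0 <= j (y - x) + (g - f) q + (r - s).
Proof.
move=> xmin seg jx fq; set h := y - x; set k := g - f.
rewrite leNgt; apply/negP => neg.
pose e := - (j h + k q + (r - s)); have e0 : 0 < e by rewrite oppr_gt0.
have hk0 : 0 < `|h| + `|k| + 1 by rewrite ltr_wpDl// addr_ge0.
have e1 : 0 < e / (`|h| + `|k| + 1) by rewrite divr_gt0.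
have [d1 d10 H1] := duality_map_ray h ucX' e1 jx.
have [d2 d20 H2] := duality_inverse_ray k ucX e1 fq.
(* For this [t], replacing [j] and [q] by the duality images [j'] and [q'] at the displaced point
   changes the expression by less than [e]. *)
pose t := Num.min 1 (Num.min d1 d2).
have t0 : 0 < t by rewrite !lt_min ltr01 d10 d20.
have t1 : t <= 1 by rewrite ge_min lexx.
have td1 : t <= d1 by rewrite !ge_min lexx orbT.
have td2 : t <= d2 by rewrite !ge_min lexx !orbT.
have t01 : 0 < t <= 1 by rewrite t0.
have [j' j'x] := duality_map_exists (x + t *: h).
have [q' fq'] := norm_attained (f + t *: k) ucX.
have {}H1 := H1 _ _ t01 td1 j'x; have {}H2 := H2 _ _ t01 td2 fq'.
have := xmin _ (seg t t01); rewrite /quad_obj /= -/h -/k.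
have := dual_young j' x; have := dual_young f q'.
move: j'x fq' => [j'x <-] [fq' <-].
have -> : f q' = `|f + t *: k| ^+ 2 - t * k q'.
  by rewrite -fq' dualDE dualZE; lra.
have -> : j' x = `|j'| ^+ 2 - t * j' h.
  by rewrite -j'x linearD linearZ /= /GRing.scale /=; lra.
move=> Y1 Y2 Y3.
have : 0 <= t * (j' h + k q' + (r - s)) by lra.
rewrite pmulr_rge0// => pos.
have E1 : (j' - j) h = j' h - j h := dualBE _ _ _.
have E2 : k (q' - q) = k q' - k q := linearB k _ _.
have : e <= (j' - j) h + k (q' - q) by rewrite E1 E2 /e; lra.
have : (j' - j) h <= `|j' - j| * `|h|.
  exact: le_trans (ler_norm _) (dual_le_norm _ _).
have : k (q' - q) <= `|k| * `|q' - q|.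
  exact: le_trans (ler_norm _) (dual_le_norm _ _).
move: H1 H2; rewrite !ltr_pdivlMr// => H1 H2 K1 K2.
have := normr_ge0 (j' - j); have := normr_ge0 (q' - q).
move: (normr_ge0 h) (normr_ge0 k) hk0 H1 H2 K1 K2 e0.
move: `|h| `|k| `|j' - j| `|q' - q| => a b c d a0 b0 hk0 H1 H2 K1 K2 e0 _ _ K3.
have := ler_wpM2l a0 (ltW H1); have := ler_wpM2l b0 (ltW H2).
have := ler_wpM2l (ltW hk0) (le_trans K3 (lerD K2 K1)); lra.
Qed.

End optimality.

(** * Maximal monotone operators *)

Section maximal_monotone_theory.
Variables (R : realType) (X : completeNormedModType R).
Hypotheses (ucX : uniformly_convex X) (ucX' : uniformly_convex (dual X)).
Implicit Types A : X -> set (dual X).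

Definition saturated A : Prop := forall x f,
  (forall y g, A y g -> 0 <= (f - g) (x - y)) -> A x f.

(** Otherwise adjoining the single pair (x, f) to the graph would give a proper monotone
    extension. *)
Lemma maximal_monotone_saturated A : maximal_monotone A -> saturated A.
Proof.
move=> [mA maxA] x f H; apply: contrapT => nAxf; apply: maxA.
exists (fun y => [set g | A y g \/ (y = x /\ g = f)]).
  move=> y y' g g' [Ayg|[-> ->]] [Ayg'|[-> ->]]; first exact: mA.
  - by rewrite -(opprB f g) -(opprB x y) dualNE linearN /= opprK; exact: H.
  - exact: H.
  - by rewrite !subrr linear0.
split=> [|BA]; first by move=> [y g] /= ?; left.
by apply: nAxf; apply: (BA (x, f)) => /=; right.
Qed.

(* Minty-Browder.  The squared norms plus the Fitzpatrick function of [A],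
   encoded by its epigraph [C], attain their minimum [m]; the optimality
   condition exhibits a pair at monotone distance at least [m] from [A], so that
   maximality forces [m <= 0], which is only possible at a solution. *)
Lemma minty A : monotone_op A -> saturated A -> (exists x, op_domain A x) ->
  exists x f, A x f /\ duality_pair (- f) x.
Proof.
move=> mA sA [a0 [b0 Ab0]].
pose C := [set p : X * dual X * R |
  forall a b, A a b -> b p.1.1 + p.1.2 a - b a <= p.2].
have CE x f s :
  C (x, f, s) = forall a b, A a b -> b x + f a - b a <= s by [].
have CA a b : A a b -> C (a, b, b a).
  rewrite CE => Aab a' b' Aab'; have := mA _ _ _ _ Aab Aab'.
  by rewrite dualBE !linearB /=; lra.
have seg p p' (t : R) : 0 <= t <= 1 -> C p -> C p' ->
    C (p.1.1 + t *: (p'.1.1 - p.1.1), p.1.2 + t *: (p'.1.2 - p.1.2),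
       p.2 + t * (p'.2 - p.2)).
  move=> /andP[t0 t1] Cp Cp'; rewrite CE => a b Aab.
  have := ler_wpM2l t0 (Cp' _ _ Aab).
  have u0 : 0 <= 1 - t by lra.
  have := ler_wpM2l u0 (Cp _ _ Aab).
  rewrite dualDE dualZE dualBE linearD linearZ /= linearB /=.
  by rewrite /GRing.scale /=; lra.
(* The single pair (a0, b0) of the graph already bounds the height from below linearly. *)
pose K := `|b0| + `|a0| + `|b0 a0|.
have [|||||[[x f] s] Cx xmin] := @quad_obj_min R X (dual X) C K ucX ucX'.
- by exists (a0, b0, b0 a0); exact: CA.
- by rewrite !addr_ge0.
- move=> p p' Cp Cp'; rewrite CE => a b Aab.
  have := Cp _ _ Aab; have := Cp' _ _ Aab.
  by rewrite dualZE dualDE linearZ /= linearD /= /GRing.scale /=; lra.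
- move=> x y s a b c Cn xa yb sc; rewrite CE => a' b' Aab.
  apply: (ler_cvg_to _ sc (f := fun n => b' (x n) + y n a' - b' a')).
    apply: cvgB; last exact: cvg_cst.
    apply: cvgD; last exact: dual_eval_cvg.
    by apply: continuous_cvg => //; exact: dual_continuous.
  by apply: nearW => n; exact: Cn.
- move=> [[x f] s] /= Cp; have := Cp _ _ Ab0 => /=.
  have := dual_le_norm b0 x; have := dual_le_norm f a0; rewrite !ler_norml.
  move=> /andP[F1 _] /andP[F2 _].
  have := ler_norm (b0 a0); have := normr_ge0 x; have := normr_ge0 f.
  have := normr_ge0 a0; have := normr_ge0 b0; have := normr_ge0 (b0 a0).
  rewrite /K; move: `|b0| `|a0| `|b0 a0| `|x| `|f| F1 F2 => k1 k2 k3 nx nf *.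
  by nra.
have {}Cx : C (x, f, s) := Cx.
have := Cx; rewrite CE => Fx.
have [j jx] := duality_map_exists x.
have [q fq] := norm_attained f ucX.
pose m := quad_obj (x, f, s).
(* Optimality in the direction of the point (a, b, b a) of [C], combined with Young's lower bound on
   [j q]. *)
have opt a b : A a b -> m <= (- j - b) (- q - a).
  move=> Aab; have := @quad_obj_min_variational R X ucX ucX' C x f s a b (b a) j q.
  move=> /(_ xmin) /(_ _ jx fq) H.
  have {}H : 0 <= j (a - x) + (b - f) q + (b a - s).
    apply: H => t /andP[t0 t1].
    by have := seg (x, f, s) _ t _ Cx (CA _ _ Aab); rewrite (ltW t0) => /(_ t1).
  move: H; rewrite !dualBE dualNE !linearB /= !linearN /= jx.1 fq.1.
  rewrite /m /quad_obj /=; have := dual_youngN j q; rewrite -fq.2 -jx.2; lra.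
(* If m > 0, saturation puts (-q, -j) in the graph, and [opt] at that very pair gives m <= 0. *)
have m0 : m <= 0.
  rewrite leNgt; apply/negP => m_gt0.
  have Aqj : A (- q) (- j).
    by apply: sA => a b /opt; apply: le_trans; exact: ltW.
  by have := opt _ _ Aqj; rewrite subrr dual0E leNgt m_gt0.
have {}m0 : `|x| ^+ 2 / 2 + `|f| ^+ 2 / 2 + s <= 0 := m0.
have rel a b : A a b -> f x + (`|x| ^+ 2 / 2 + `|f| ^+ 2 / 2) <= (f - b) (x - a).
  by move=> /Fx; rewrite dualBE !linearB /=; lra.
have Axf : A x f.
  apply: sA => a b /rel; apply: le_trans.
  by have := dual_youngN f x; lra.
exists x, f; split => //.
(* [rel] at (x, f) itself turns Young's lower bound into an equality. *)
have fx : f x = - (`|x| ^+ 2 / 2 + `|f| ^+ 2 / 2).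
  apply/eqP; rewrite eq_le; have := rel _ _ Axf; rewrite !subrr linear0.
  by have := dual_youngN f x => *; apply/andP; split; lra.
have nfx : `|x| = `|f|.
  have := dual_le_norm f x; rewrite ler_norml fx => /andP[H _].
  apply/eqP; rewrite -subr_eq0 -sqrf_eq0 eq_le sqr_ge0 andbT; lra.
by apply: duality_pair_intro; rewrite ?normrN ?nfx// dualNE fx nfx; lra.
Qed.

(** [minty] for the operator sending [w] to A (x + l w) - z, which inherits monotonicity and
    saturation from [A]. *)
Lemma resolvent A (x : X) (z : dual X) (l : R) :
  maximal_monotone A -> (exists x, op_domain A x) -> 0 < l ->
  exists w g, A (x + l *: w) g /\ duality_pair (z - g) w.
Proof.
move=> maxA [a0 [b0 Ab0]] l0.
have mA := maxA.1; have sA := maximal_monotone_saturated maxA.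
pose B w := [set k | A (x + l *: w) (k + z)].
have diff w w' : x + l *: w - (x + l *: w') = l *: (w - w').
  by rewrite opprD addrACA subrr add0r scalerBr.
have toB y g : A y g -> B (l^-1 *: (y - x)) (g - z).
  by rewrite /B /= subrK scalerA mulfV ?gt_eqF// scale1r addrC subrK.
have [|||w [k [Bwk kw]]] := @minty B.
- move=> w w' k k' Bw Bw'; have := mA _ _ _ _ Bw Bw'.
  rewrite diff opprD addrACA subrr addr0 linearZ_dual.
  by rewrite pmulr_rge0.
- move=> w k H; apply: sA => y g Ayg.
  have := H _ _ (toB _ _ Ayg).
  have -> : x + l *: w - y = l *: (w - l^-1 *: (y - x)).
    rewrite scalerBr scalerA mulfV ?gt_eqF// scale1r opprB addrA.
    by rewrite (addrC x).
  have -> : k + z - g = k - (g - z) by rewrite opprB addrA.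
  by move=> H1; rewrite linearZ; exact: mulr_ge0 (ltW l0) H1.
- by exists (l^-1 *: (a0 - x)), (b0 - z); exact: toB.
by exists w, (k + z); split => //; rewrite opprD addrCA subrr addr0.
Qed.

(** By saturation [A x] is an intersection of closed half-spaces, so [quad_obj_min], with the other
    coordinates frozen at 0, provides a minimizer and [xget] does not return its default. *)
Lemma min_norm_selectionP A x : maximal_monotone A -> op_domain A x ->
  min_norm_elements A x (min_norm_selection A x).
Proof.
move=> maxA [f0 Af0].
have sA := maximal_monotone_saturated maxA; have mA := maxA.1.
pose C := [set p : dual X * dual X * R | [/\ A x p.1.1, p.1.2 = 0 & p.2 = 0]].
have [|||||[[f g] s] [/= Af g0 s0] fmin] :=
    @quad_obj_min R (dual X) (dual X) C 0 ucX' ucX'.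
- by exists (f0, 0, 0).
- exact: lexx.
- move=> p q [/= Ap p1 p2] [/= Aq q1 q2]; split => /=; last 2 first.
  + by rewrite p1 q1 addr0 scaler0.
  + by rewrite p2 q2 addr0 mulr0.
  apply: sA => y h Ayh; have := mA _ _ _ _ Ap Ayh; have := mA _ _ _ _ Aq Ayh.
  by rewrite !dualBE dualZE dualDE; lra.
- move=> u v s a b c Cn ua vb sc; split => /=.
  + apply: sA => y h Ayh.
    have ev : ((u n - h) (x - y) : R) @[n --> \oo] --> (a - h) (x - y).
      by apply: dual_eval_cvg; apply: cvgB => //; exact: cvg_cst.
    apply: (cvgr_to_ge ev).
    by apply: nearW => n; apply: mA => //; have [] := Cn n.
  + apply: (cvg_unique _ vb) => //.
    have -> : v = (fun=> 0) by apply/funext => n; have [] := Cn n.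
    exact: cvg_cst.
  + apply: (cvg_unique _ sc) => //.
    have -> : s = (fun=> 0) by apply/funext => n; have [] := Cn n.
    exact: cvg_cst.
- by move=> [[u v] s] [/= _ _ ->]; rewrite oppr0 mul0r.
apply: xgetPex; exists f; split => // h Ah.
have := fmin (h, 0, 0); rewrite /quad_obj /= g0 s0 normr0 => H.
rewrite -(@ler_pXn2r _ 2) ?nnegrE//.
by have := H (And3 Ah erefl erefl); lra.
Qed.

(** * Comparison of two operators through their selections *)

Lemma maximal_monotone_sub_of_selection A1 A2 (x : X) (z : dual X) (r : R) :
  maximal_monotone A1 -> maximal_monotone A2 -> 0 < r ->
  (forall y, `|x - y| < r -> op_domain A2 y ->
    op_domain A1 y /\ min_norm_selection A1 y = min_norm_selection A2 y) ->
  op_domain A2 x -> A1 x z -> A2 x z.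
Proof.
move=> max1 max2 r0 sel D2x A1xz; have [h A2h] := D2x.
have m1 := max1.1; have m2 := max2.1.
have res (l : R) : exists p : X * dual X, 0 < l ->
    A2 (x + l *: p.1) p.2 /\ duality_pair (z - p.2) p.1.
  have [l0|l0] := ltP 0 l; last by exists (0, 0).
  have [w [g H]] := resolvent x z max2 (ex_intro _ x D2x) l0.
  by exists (w, g).
have [p Hp] := choice res.
pose w l := (p l).1; pose g l := (p l).2.
have A2g l : 0 < l -> A2 (x + l *: w l) (g l) by move=> /Hp[].
have dw l : 0 < l -> duality_pair (z - g l) (w l) by move=> /Hp[].
clearbody w g; clear p Hp res.
pose K := `|z - h|.
have K0 : 0 <= K := normr_ge0 _.
(* Monotonicity against [h] in [A2 x] gives |w_l|^2 = <z - g_l, w_l> <= <z - h, w_l>. *)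
have wK l : 0 < l -> `|w l| <= K.
  move=> l0; have := m2 _ _ _ _ (A2g l l0) A2h.
  rewrite (addrC x) addrK linearZ_dual pmulr_rge0// dualBE.
  have [dz dzn] := dw l l0; move=> H.
  have : `|w l| ^+ 2 <= K * `|w l|.
    rewrite -dzn -dz; apply: le_trans (_ : (z - h) (w l) <= _).
      by rewrite !dualBE; lra.
    by apply: le_trans (ler_norm _) _; rewrite dzn; exact: dual_le_norm.
  have [->|w0] := eqVneq (w l) 0; first by rewrite normr0.
  by rewrite expr2 ler_pM2r// normr_gt0.
(* For 0 < l < l0 the point x + l w_l stays within distance [r] of [x], where the selections
   agree. *)
pose l0 := r / (K + 1).
have l00 : 0 < l0 by rewrite divr_gt0// ltr_wpDl.
pose C := `|z| + K.
have C0 : 0 <= C := addr_ge0 (normr_ge0 z) K0.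
pose f l := min_norm_selection A2 (x + l *: w l).
have fP l : 0 < l < l0 ->
    [/\ A1 (x + l *: w l) (f l), A2 (x + l *: w l) (f l) & `|f l| <= C].
  move=> /andP[lp ll0].
  have D2 : op_domain A2 (x + l *: w l) by exists (g l); exact: A2g.
  have [] := sel (x + l *: w l) _ D2.
    rewrite opprD addrA subrr add0r normrN normrZ gtr0_norm//.
    move: ll0; rewrite /l0 ltr_pdivlMr ?ltr_wpDl//.
    by have := ler_wpM2l (ltW lp) (wK l lp); lra.
  move=> D1 selE; have [A1f _] := min_norm_selectionP max1 D1.
  have [A2f fmin] := min_norm_selectionP max2 D2.
  split => //; first by rewrite /f -selE.
  apply: le_trans (fmin _ (A2g l lp)) _.
  have -> : g l = z - (z - g l) by rewrite subKr.
  apply: le_trans (ler_normB _ _) _; rewrite lerD2l (dw l lp).2; exact: wK.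
have gC l : 0 < l -> `|g l| <= C.
  move=> lp; have -> : g l = z - (z - g l) by rewrite subKr.
  apply: le_trans (ler_normB _ _) _; rewrite lerD2l (dw l lp).2; exact: wK.
have diff (l u : R) (a b : X) : x + u *: a - (x + l *: b) = u *: a - l *: b.
  by rewrite opprD addrACA subrr add0r.
have pairK (k : dual X) (y : X) (a b : R) : `|k| <= a -> `|y| <= b -> k y <= a * b.
  move=> ka yb; apply: le_trans (ler_norm _) _; apply: le_trans (dual_le_norm _ _) _.
  exact: ler_pM.
(* With l = t u, monotonicity of [A2] between g_u and g_l gives |w_u|^2 - t K^2 <= <z - g_l, w_u>,
   and Young's inequality bounds the right side by the squared midpoint. *)
have mid t u : 0 < t -> 0 < u ->
    `|w u| ^+ 2 - t * K ^+ 2 <= `|2^-1 *: (w (t * u) + w u)| ^+ 2.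
  move=> t0 u0; have l0' : 0 < t * u by rewrite mulr_gt0.
  apply: le_trans (duality_pair_midpoint_ge (w u) (dw _ l0')).
  have := m2 _ _ _ _ (A2g u u0) (A2g _ l0'); rewrite diff -scalerA.
  have [du dun] := dw u u0; have [dl dln] := dw _ l0'.
  have := pairK (z - g u) (w (t * u)) K K; rewrite dun => /(_ (wK u u0) (wK _ l0')).
  move=> H1.
  have E : u *: w u - (t * u) *: w (t * u) = u *: (w u - t *: w (t * u)).
    by rewrite scalerBr scalerA (mulrC u).
  rewrite scalerA E linearZ_dual pmulr_rge0// linearB_dual linearZ_dual => H2.
  have := ler_wpM2l (ltW t0) H1.
  have : 0 <= t * `|z - g (t * u)| ^+ 2 by rewrite mulr_ge0 ?sqr_ge0// ltW.
  rewrite -dun -du -dl; move: H2; rewrite !dualBE; lra.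
(* Split <z - g_u, w_u> into <z - f_l, w_u - w_l>, <z - f_l, w_l> and <f_l - g_u, w_u>. The second
   is at most 0 by [A1], the third at most t <f_l - g_u, w_l> by [A2]. *)
have key t u : 0 < t -> 0 < u < l0 -> 0 < t * u < l0 ->
    `|w u| ^+ 2 <= (`|z| + C) * `|w u - w (t * u)| + t * (2 * C * K).
  move=> t0 u0 tu0; have up := (andP u0).1; have lp := (andP tu0).1.
  have [A1f A2f fC] := fP _ tu0.
  have := m2 _ _ _ _ (A2g u up) A2f; rewrite diff.
  have E : u *: w u - (t * u) *: w (t * u) = u *: (w u - t *: w (t * u)).
    by rewrite scalerBr scalerA (mulrC u).
  rewrite E linearZ_dual pmulr_rge0// linearB_dual linearZ_dual => H2.
  have := m1 _ _ _ _ A1f A1xz; rewrite (addrC x) addrK linearZ_dual.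
  rewrite pmulr_rge0// => H3.
  have H4 : (f (t * u) - g u) (w (t * u)) <= 2 * C * K.
    apply: pairK (wK _ lp); apply: le_trans (ler_normB _ _) _.
    have := gC u up; lra.
  have H5 : (z - f (t * u)) (w u - w (t * u)) <= (`|z| + C) * `|w u - w (t * u)|.
    apply: pairK => //; apply: le_trans (ler_normB _ _) _; lra.
  have := ler_wpM2l (ltW t0) H4.
  have [du dun] := dw u up; rewrite -dun -du.
  by move: H2 H3 H5; rewrite !dualBE !linearB_dual; lra.
pose S := [set `|w u| ^+ 2 | u in [set u | 0 < u < l0]].
have hlf : 0 < l0 / 2 < l0 by apply/andP; split; lra.
have supS : has_sup S.
  split; first by exists (`|w (l0 / 2)| ^+ 2), (l0 / 2).
  exists (K ^+ 2) => _ [u /= /andP[u0 _] <-].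
  by rewrite ler_pXn2r ?nnegrE//; exact: wK.
have leL u : 0 < u < l0 -> `|w u| ^+ 2 <= sup S.
  by move=> u0; apply: ub_le_sup; [exact: supS.2|exists u].
suff L0 : sup S <= 0.
  have wn0 : `|w (l0 / 2)| ^+ 2 <= 0 by apply: le_trans (leL _ hlf) L0.
  have w0 : w (l0 / 2) = 0.
    by apply/eqP; rewrite -normr_eq0 -sqrf_eq0 eq_le wn0 sqr_ge0.
  have hp := (andP hlf).1; have := A2g _ hp; rewrite w0 scaler0 addr0.
  have [_ ] := dw _ hp; rewrite w0 normr0 => /eqP.
  by rewrite normr_eq0 subr_eq0 => /eqP ->.
apply/ler_addgt0Pr => e e0; rewrite add0r.
(* Collects the coefficients of [eps]: 1 from the choice of [u], |z| + C from |w_u - w_l|, and 2 C K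
   from t <= eps. *)
pose Q := 1 + `|z| + C + 2 * C * K.
have Q0 : 0 < Q.
  rewrite /Q; have := normr_ge0 z; have := mulr_ge0 C0 K0; lra.
pose eps := e / Q; have eps0 : 0 < eps by rewrite divr_gt0.
have eQ : e = eps * Q by rewrite divfK// gt_eqF.
have [d d0 ucd] := uniformly_convex_sqr K ucX eps0.
have d1 : 0 < Num.min d eps by rewrite lt_min d0.
have [_ [u /= u0 <-]] := sup_adherent d1 supS.
rewrite ltrBlDr => Lu.
have Lud : sup S < `|w u| ^+ 2 + d.
  by apply: lt_le_trans Lu _; rewrite lerD2l ge_min lexx.
have Lue : sup S < `|w u| ^+ 2 + eps.
  by apply: lt_le_trans Lu _; rewrite lerD2l ge_min lexx orbT.
have KK : 0 < K ^+ 2 + 1 by rewrite ltr_wpDl// sqr_ge0.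
(* The bound 1/2 keeps t u below [l0]; the last one makes t K^2 < d/2, which with the choice of [u]
   brings the midpoint gap below [d]. *)
pose t := Num.min 2^-1 (Num.min eps (d / (2 * (K ^+ 2 + 1)))).
have t0 : 0 < t.
  have dK : 0 < d / (2 * (K ^+ 2 + 1)) by rewrite divr_gt0// mulr_gt0.
  by rewrite !lt_min eps0 dK !andbT; lra.
have t1 : t <= 2^-1 by rewrite ge_min lexx.
have te : t <= eps by rewrite !ge_min lexx orbT.
have td : t * (2 * (K ^+ 2 + 1)) <= d.
  by rewrite -ler_pdivlMr ?mulr_gt0// !ge_min lexx !orbT.
have [up ul] := andP u0.
have tu0 : 0 < t * u < l0.
  by rewrite mulr_gt0//= (le_lt_trans _ ul)// ler_piMl ?(ltW up)//; lra.
have wtu : `|w u - w (t * u)| < eps.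
  rewrite distrC; apply: ucd; [exact: wK (andP tu0).1|exact: wK|].
  by have := mid _ _ t0 up; have := leL _ tu0; lra.
have zC0 : 0 <= `|z| + C := addr_ge0 (normr_ge0 z) C0.
have CK0 : 0 <= 2 * C * K by rewrite !mulr_ge0.
have := key _ _ t0 u0 tu0; have := ler_wpM2l zC0 (ltW wtu).
have := ler_wpM2r CK0 te; rewrite eQ /Q; lra.
Qed.

End maximal_monotone_theory.

(** * The local and global statements *)

Theorem corollary3p2 (R : realType) (X : completeNormedModType R)
    (A1 A2 : X -> set (dual X)) :
  uniformly_convex X -> uniformly_convex (dual X) ->
  maximal_monotone A1 -> maximal_monotone A2 ->
  (forall (x0 : X) (r : R),
    (op_domain A1 `&` op_domain A2) x0 -> 0 < r ->
    op_domain A1 `&` ball x0 r = op_domain A2 `&` ball x0 r ->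
    (forall x, (op_domain A1 `&` ball x0 r) x ->
      min_norm_selection A1 x = min_norm_selection A2 x) ->
    forall x, (op_domain A1 `&` ball x0 r) x -> A1 x = A2 x) /\
  (op_domain A1 = op_domain A2 ->
    (forall x, op_domain A1 x ->
      min_norm_selection A1 x = min_norm_selection A2 x) ->
    A1 = A2).
Proof.
move=> ucX ucX' max1 max2.
have local (x0 : X) (r : R) :
    op_domain A1 `&` ball x0 r = op_domain A2 `&` ball x0 r ->
    (forall x, (op_domain A1 `&` ball x0 r) x ->
      min_norm_selection A1 x = min_norm_selection A2 x) ->
    forall x, (op_domain A1 `&` ball x0 r) x -> A1 x = A2 x.
  move=> DE sel x D1x; have := D1x; rewrite DE => D2x.
  have x0x : `|x0 - x| < r by have := D1x.2; rewrite -ball_normE.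
  (* The comparison is centred at [x] itself, on a smaller ball contained in the given one. *)
  have rx : 0 < r - `|x0 - x| by rewrite subr_gt0.
  have inball y : `|x - y| < r - `|x0 - x| -> ball x0 r y.
    move=> xy; rewrite -ball_normE /=.
    by apply: le_lt_trans (ler_distD x _ _) _; lra.
  apply/seteqP; split => z Az.
    apply: (maximal_monotone_sub_of_selection ucX ucX' max1 max2 rx _ D2x.1 Az).
    move=> y /inball yb D2y.
    have D1y : (op_domain A1 `&` ball x0 r) y by rewrite DE.
    by split; [exact: D1y.1|exact: sel].
  apply: (maximal_monotone_sub_of_selection ucX ucX' max2 max1 rx _ D1x.1 Az).
  move=> y /inball yb D1y.
  have D2y : (op_domain A2 `&` ball x0 r) y by rewrite -DE.
  by split; [exact: D2y.1|rewrite sel].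
split=> [x0 r _ _|DE sel]; first exact: local.
(* On the domain the local statement applies with centre [x] and radius 1; off it both values are
   empty. *)
apply/funext => x; have [D1x|D1x] := pselect (op_domain A1 x).
  apply: (local x 1); rewrite ?DE//; first by move=> y [D2y _]; apply: sel; rewrite DE.
  by split; [rewrite -DE|exact: ballxx].
have D2x : ~ op_domain A2 x by rewrite -DE.
by apply/seteqP; split => z Az; [case: D1x|case: D2x]; exists z.
Qed.
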